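(* If $K$ is an $(H,A,B,O)$-graph on $n$ vertices and $K$ has at least $(n+1)/2$ 2-chords, then $\gamma(K)\le \lceil 2n/7\rceil$.
   Context: $\gamma(K)$ denotes the domination number of $K$ (minimum size of a set $D$ of vertices such that every vertex is in $D$ or adjacent to a vertex of $D$). Let $K$ be a (simple) graph on $n$ vertices with a Hamilton cycle $H=x_1x_2\cdots x_nx_1$; indices are taken modulo $n$. A 2-chord is an edge of the form $x_ix_{i+2}$. Define three kinds of subgraphs: an $A$ is a 3-cycle $x_ix_{i+1}x_{i+2}x_i$ (the path $x_ix_{i+1}x_{i+2}$ of $H$ plus the 2-chord $x_ix_{i+2}$) with $\deg_K(x_{i+1})=2$; a $B$ is the subgraph on four vertices consisting of the path $x_ix_{i+1}x_{i+2}x_{i+3}$ of $H$ together with the edges $x_ix_{i+2}$ and $x_{i+1}x_{i+3}$, with $\deg_K(x_{i+1})=\deg_K(x_{i+2})=3$; an $O$ is a single edge $x_ix_{i+1}$ of $H$ (with its endvertices) such that for each endvertex $x_j$ of it there is no edge $x_{j-1}x_{j+1}$. The pair $(K,H)$ is an $(H,A,B,O)$-graph if: (1) every edge of $E(K)\setminus E(H)$ is a 2-chord; (2) every edge of $K$ lies on $H$ or lies in an $A$ or a $B$; (3) $K$ is the union of $A$s, $B$s and $O$s (consecutive along $H$), any two of which intersect in at most one vertex. *)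

(* Defs.v *)
From HB Require Import structures.
From mathcomp Require Import all_boot all_order all_algebra.

Set Implicit Arguments.
Unset Strict Implicit.
Unset Printing Implicit Defensive.

Section Graph.
Variables (T : finType) (e : rel T).

Definition simple_graph := symmetric e /\ irreflexive e.

Definition edges : {set {set T}} :=
  [set [set u; v] | u in T, v in T & e u v].

Definition degree (v : T) : nat := #|[set u | e v u]|.

Definition dominating (D : {set T}) : bool :=
  [forall v, (v \in D) || [exists u in D, e u v]].

Definition domination_number : nat :=
  #|[arg min_(D < [set: T] | dominating D) #|D| ]|.

End Graph.

(* The index [i + k], taken modulo n. *)
Definition shift n (i : 'I_n) (k : nat) : 'I_n := iter k (@ordS n) i.

Inductive kind := A | B | O.

(* [(k, i)] is the subgraph of kind [k] whose path along H starts at [x i]. *)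
Definition piece n := (kind * 'I_n)%type.

Section HamiltonCycle.
Variables (T : finType) (e : rel T) (n : nat) (x : 'I_n -> T).

Definition hamilton_cycle :=
  [/\ 2 < n, bijective x & forall i, e (x i) (x (shift i 1))].

Definition cycle_edges : {set {set T}} := [set [set x i; x (shift i 1)] | i : 'I_n].

Definition two_chords : {set {set T}} :=
  [set E in edges e | [exists i, E == [set x i; x (shift i 2)]]].

Definition piece_start (p : piece n) : 'I_n := p.2.

Definition piece_end (p : piece n) : 'I_n :=
  let: (k, i) := p in
  match k with A => shift i 2 | B => shift i 3 | O => shift i 1 end.

Definition piece_vertices (p : piece n) : {set T} :=
  let: (k, i) := p in
  match k with
  | A => [set x i; x (shift i 1); x (shift i 2)]
  | B => [set x i; x (shift i 1); x (shift i 2); x (shift i 3)]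
  | O => [set x i; x (shift i 1)]
  end.

Definition piece_edges (p : piece n) : {set {set T}} :=
  let: (k, i) := p in
  match k with
  | A => [set [set x i; x (shift i 1)]; [set x (shift i 1); x (shift i 2)];
              [set x i; x (shift i 2)]]
  | B => [set [set x i; x (shift i 1)]; [set x (shift i 1); x (shift i 2)];
              [set x (shift i 2); x (shift i 3)];
              [set x i; x (shift i 2)]; [set x (shift i 1); x (shift i 3)]]
  | O => [set [set x i; x (shift i 1)]]
  end.

Definition no_chord_over (j : 'I_n) : bool :=
  ~~ e (x (ord_pred j)) (x (shift j 1)).

Definition is_piece (p : piece n) : bool :=
  (piece_edges p \subset edges e) &&
  let: (k, i) := p in
  match k with
  | A => degree e (x (shift i 1)) == 2
  | B => [&& #|piece_vertices p| == 4,
             degree e (x (shift i 1)) == 3 & degree e (x (shift i 2)) == 3]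
  | O => no_chord_over i && no_chord_over (shift i 1)
  end.

(* The pieces are listed in their order along H, each one starting where the
   previous one ends. That the last one ends where the first one starts is not
   required here: for n >= 4 it follows from the other conditions. *)
Definition is_decomposition (s : seq (piece n)) : Prop :=
  [/\ all is_piece s,
      sorted (fun p q => piece_end p == piece_start q) s,
      \bigcup_(p <- s) piece_vertices p = [set: T],
      \bigcup_(p <- s) piece_edges p = edges e
    & pairwise (fun p q => #|piece_vertices p :&: piece_vertices q| <= 1) s].

Definition HABO_graph : Prop :=
  [/\ edges e :\: cycle_edges \subset two_chords,
      forall E, E \in edges e ->
        E \in cycle_edges \/
        exists k i, [/\ k = A \/ k = B, is_piece (k, i) & E \in piece_edges (k, i)]
    & exists s, is_decomposition s].

End HamiltonCycle.

(* Main.v *)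
Require Import Defs.
From mathcomp Require Import all_boot all_order all_algebra.
From mathcomp Require Import zify.

Set Implicit Arguments.
Unset Strict Implicit.
Unset Printing Implicit Defensive.

Import Order.TTheory GRing.Theory Num.Theory.

(* Let a, b, o be the numbers of A's, B's and O's.  For n >= 5 the cycle edges are
   partitioned by the pieces, so n = 2a + 3b + o and the last piece ends where the
   first one starts; there are at most a + 2b 2-chords, so b > o.  Build a
   dominating set piece by piece along H: a vertex joining two consecutive pieces
   is either chosen, or dominated from the left, or exposed (to be dominated from
   the right).  A joint dominates both pieces it lies on except for the far ends of
   B's, and an inner vertex of a B dominates that B.  Each initial status gives a
   set; with the first vertex added it dominates K.  The three sets from the three
   initial statuses have total size at most 2a + 2b + o, and the two from "chosen"
   and "dominated" at most a + o + 3b/2.  One of the two averages is at most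
   (2n - 1)/7: the first if 2a + o <= 4b - 3, the second otherwise; so
   7 gamma(K) <= 2n + 6. *)

(** * Indices modulo n along the cycle *)

Definition klen (k : kind) : nat := match k with A => 2 | B => 3 | O => 1 end.

Lemma val_shift n (i : 'I_n) k : shift i k = (i + k) %% n :> nat.
Proof.
elim: k => [|k IH]; first by rewrite addn0 modn_small.
by rewrite /shift iterS /= -/(shift i k) IH -addn1 modnDml addn1 addnS.
Qed.

Lemma shiftD n (i : 'I_n) a b : shift (shift i a) b = shift i (a + b).
Proof. by rewrite /shift -iterD addnC. Qed.

Lemma shift_inj n (i : 'I_n) a b :
  a < n -> b < n -> shift i a = shift i b -> a = b.
Proof.
move=> an bn /(congr1 val) /=; rewrite !val_shift => /eqP.
by rewrite eqn_modDl !modn_small // => /eqP.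
Qed.

Lemma shift_size n (i : 'I_n) : shift i n = i.
Proof. by apply/val_inj; rewrite /= val_shift modnDr modn_small. Qed.

Lemma shift_reach n (i j : 'I_n) : exists2 t, t < n & j = shift i t.
Proof.
have n0 : 0 < n by apply: leq_ltn_trans (ltn_ord i).
(* This is j - i modulo n; adding n keeps the subtraction from truncating. *)
exists ((j + (n - i)) %% n); first by rewrite ltn_mod.
apply/val_inj; rewrite /= val_shift modnDmr addnC -addnA subnK ?(ltnW (ltn_ord i)) //.
by rewrite modnDr modn_small.
Qed.

Lemma set2_eq (T : finType) (a b c d : T) :
  [set a; b] = [set c; d] -> a = c /\ b = d \/ a = d /\ b = c.
Proof.
move=> E.
have := set21 a b; rewrite E !inE => /orP[] /eqP ac; have := set22 a b; rewrite E !inE => /orP[] /eqP bd; subst.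
- by have := set22 c d; rewrite -E !inE => /orP[] /eqP ->; left.
- by left.
- by right.
- by have := set21 c d; rewrite -E !inE => /orP[] /eqP ->; left.
Qed.

(** * Unions over a list *)

Section SeqUnion.
Variables (I : Type) (T : finType).
Implicit Types (F : I -> {set T}) (s : seq I).

Lemma bigcup_seq_sub (U : finType) F (G : I -> {set U}) s (y : T) (z : U) :
  (forall p, y \in F p -> z \in G p) ->
  y \in \bigcup_(p <- s) F p -> z \in \bigcup_(p <- s) G p.
Proof.
move=> H; elim: s => [|p s IH]; first by rewrite big_nil inE.
by rewrite !big_cons !inE => /orP[/H ->//|/IH ->]; rewrite orbT.
Qed.

Lemma card_bigcup_seq F s : #|\bigcup_(p <- s) F p| <= \sum_(p <- s) #|F p|.
Proof.
elim: s => [|p s IH]; first by rewrite !big_nil cards0.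
by rewrite !big_cons (leq_trans (leq_card_setU _ _)) // leq_add2l.
Qed.

Lemma card_bigcup_seq_disjoint F s :
  pairwise (fun p q => [disjoint F p & F q]) s ->
  \sum_(p <- s) #|F p| = #|\bigcup_(p <- s) F p|.
Proof.
elim: s => [|p s IH]; first by rewrite !big_nil cards0.
rewrite pairwise_cons !big_cons => /andP[ps /IH ->].
rewrite cardsU; suff -> : F p :&: \bigcup_(q <- s) F q = set0.
  by rewrite cards0 subn0.
elim: s ps {IH} => [|q s IH]; first by rewrite big_nil setI0.
by rewrite big_cons setIUr /= => /andP[/disjoint_setI0 -> /IH ->]; rewrite set0U.
Qed.

End SeqUnion.

(** * Steps and 2-chords of a piece *)

Section CycleGraph.
Variables (T : finType) (e : rel T) (n : nat) (x : 'I_n -> T).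
Hypotheses (sym_e : symmetric e) (inj_x : injective x).

Lemma edges_set2 u v : [set u; v] \in edges e -> e u v.
Proof.
case/imset2P=> a b _; rewrite inE => /andP[_ eab] /set2_eq[] [-> ->] //.
by rewrite sym_e.
Qed.

(** If the two pairs matched crosswise, a + b steps would lead back to the start, but 0 < a + b <= 4
    < n. For n = 4 a 2-chord does match its own reverse, which is why small cycles are treated
    apart. *)
Lemma step_edge_inj (i j : 'I_n) a b : 4 < n -> 0 < a <= 2 -> 0 < b <= 2 ->
  [set x i; x (shift i a)] = [set x j; x (shift j b)] -> i = j /\ a = b.
Proof.
move=> n5 a2 b2 /set2_eq[] [] /inj_x ij /inj_x.
  by rewrite ij => /shift_inj ->; [|lia|lia].
rewrite ij shiftD => jj; have : b + a = 0 by apply: (@shift_inj _ j); rewrite //; lia.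
lia.
Qed.

(** A cycle edge is recorded by the index of its first vertex, so a partition of the cycle edges
    becomes one of ['I_n]. *)
Definition steps (p : piece n) : {set 'I_n} :=
  [set shift p.2 (val t) | t : 'I_(klen p.1)].

Definition chords_of (p : piece n) : {set {set T}} :=
  [set [set x (shift p.2 (val t)); x (shift p.2 (val t + 2))] | t : 'I_(klen p.1).-1].

Lemma piece_edgesP p E : E \in piece_edges x p ->
  (exists2 t, t < klen p.1 & E = [set x (shift p.2 t); x (shift (shift p.2 t) 1)]) \/
  (exists2 t, t < (klen p.1).-1 & E = [set x (shift p.2 t); x (shift (shift p.2 t) 2)]).
Proof.
case: p => -[] i; rewrite !inE -?orbA.
- case/or3P=> /eqP->; [left; exists 0|left; exists 1|right; exists 0]; by [].
- by case/or4P=> [||| /orP[]] /eqP->;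
    [left; exists 0|left; exists 1|left; exists 2|right; exists 0|right; exists 1].
- by move=> /eqP->; left; exists 0.
Qed.

Lemma step_in_piece p i : 4 < n ->
  [set x i; x (shift i 1)] \in piece_edges x p -> i \in steps p.
Proof.
move=> n5 /piece_edgesP[] [t tp] /step_edge_inj[] // -> _.
by apply/imsetP; exists (Ordinal tp).
Qed.

Lemma chord_in_piece p i : 4 < n ->
  [set x i; x (shift i 2)] \in piece_edges x p ->
  [set x i; x (shift i 2)] \in chords_of p.
Proof.
move=> n5 /piece_edgesP[] [t tp] /step_edge_inj[] // -> _.
by apply/imsetP; exists (Ordinal tp); rewrite // shiftD.
Qed.

Lemma card_chords_of p : #|chords_of p| <= (klen p.1).-1.
Proof. by rewrite (leq_trans (leq_imset_card _ _)) // card_ord. Qed.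

Lemma card_steps p : 2 < n -> #|steps p| = klen p.1.
Proof.
move=> n3; have kn : klen p.1 <= n by case: p.1 => /=; lia.
rewrite card_imset ?card_ord // => t u /shift_inj E.
by apply/val_inj/E; apply: leq_trans kn; apply: ltn_ord.
Qed.

Lemma piece_vertices_step p i : i \in steps p ->
  (x i \in piece_vertices x p) && (x (shift i 1) \in piece_vertices x p).
Proof.
by case/imsetP=> -[t tp] _ ->; case: p tp => -[] j /=; case: t => [|[|[|//]]] //= _;
  rewrite !inE !eqxx ?orbT.
Qed.

(** A common step would put both of its endpoints, distinct as n > 1, into the intersection. *)
Lemma steps_disjoint p q : 1 < n ->
  #|piece_vertices x p :&: piece_vertices x q| <= 1 -> [disjoint steps p & steps q].
Proof.
move=> n2 pq; rewrite -setI_eq0; apply/eqP/setP=> i; rewrite !inE.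
apply/negP=> /andP[/piece_vertices_step/andP[p1 p2] /piece_vertices_step/andP[q1 q2]].
move: pq; apply/negP; rewrite -ltnNge.
have <- : #|[set x i; x (shift i 1)]| = 2.
  rewrite cards2 (inj_eq inj_x); case: eqP => // E.
  by have := @shift_inj _ i 0 1 (ltnW n2) n2 E.
by apply/subset_leq_card/subsetP=> v; rewrite !inE => /orP[] /eqP ->; rewrite ?p1 ?p2 ?q1 ?q2.
Qed.


(** * Partial dominating sets along a word of kinds *)

(* What is known about the first vertex of the part still to be dominated. *)
Inductive status := Chosen | Dominated | Exposed.

(** A chosen first vertex may be used but is not counted in the bound [m] of [safe]: the piece
    before it pays. *)
Definition given (c : status) (i : 'I_n) : {set T} :=
  if c is Chosen then [set x i] else set0.

Definition exempt (c : status) (i : 'I_n) : {set T} :=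
  if c is Dominated then [set x i] else set0.

Definition covers (D : {set T}) (v : T) : bool :=
  [exists u in D, (u == v) || e u v].

Definition word_len (ks : seq kind) : nat := sumn (map klen ks).

(* The last vertex, of index [shift i (word_len ks)], is not required to be
   dominated. *)
Definition safe (c : status) (i : 'I_n) (ks : seq kind) (m : nat) : Prop :=
  exists2 D : {set T}, #|D| <= m & forall t, t < word_len ks ->
    (x (shift i t) \in exempt c i) || covers (given c i :|: D) (x (shift i t)).

Definition present (i : 'I_n) (k : kind) : Prop := piece_edges x (k, i) \subset edges e.

Fixpoint laid (i : 'I_n) (ks : seq kind) : Prop :=
  if ks is k :: ks' then present i k /\ laid (shift i (klen k)) ks' else True.

Lemma coversS (D D' : {set T}) v : D \subset D' -> covers D v -> covers D' v.
Proof.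
move=> /subsetP DD /exists_inP[u uD uv]; apply/exists_inP; exists u => //.
exact: DD.
Qed.

Lemma covers_mem (D : {set T}) v : v \in D -> covers D v.
Proof. by move=> vD; apply/exists_inP; exists v; rewrite ?eqxx. Qed.

Lemma present_adj k i s d : present i k -> 0 < d <= 2 -> s + d <= klen k ->
  e (x (shift i s)) (x (shift i (s + d))).
Proof.
move=> /subsetP E; case: d => [|[|[|//]]] // _; rewrite ?addn1 ?addn2 => sk;
  apply: edges_set2; apply: E; move: sk; case: k => /=; case: s => [|[|[|//]]] //= _;
  by rewrite !inE !eqxx ?orbT.
Qed.

(** Vertices of a piece at most two steps apart are equal or adjacent; only the two ends of a [B]
    are further apart. *)
Lemma covers_near k i s t (D : {set T}) : present i k -> s <= klen k -> t <= klen k ->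
  s <= t + 2 -> t <= s + 2 -> x (shift i s) \in D -> covers D (x (shift i t)).
Proof.
move=> ki sk tk st ts sD; apply/exists_inP; exists (x (shift i s)) => //.
have [lt|lt|->] := ltngtP s t; last by rewrite eqxx.
  by rewrite -(subnKC (ltnW lt)) (present_adj ki) ?orbT //; lia.
by rewrite sym_e -(subnKC (ltnW lt)) (present_adj ki) ?orbT //; lia.
Qed.

(** [X] is the set of vertices bought while crossing the piece. It turns status [c] into [c'] and
    takes care of all of the piece but its last vertex, so it can be joined to the set for the
    rest. *)
Lemma safe_step c c' k i ks (X : {set T}) m m' :
  let i' := shift i (klen k) in
  m' = #|X| + m ->
  given c' i' \subset given c i :|: X ->
  (forall v, v \in exempt c' i' -> covers (given c i :|: X) v) ->
  (forall t, t < klen k ->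
    (x (shift i t) \in exempt c i) || covers (given c i :|: X) (x (shift i t))) ->
  safe c' i' ks m -> safe c i (k :: ks) m'.
Proof.
move=> i' -> G E V [D Dm H]; exists (X :|: D).
  by rewrite (leq_trans (leq_card_setU _ _)) // leq_add2l.
move=> t; rewrite /word_len /= -/(word_len ks) => tk; rewrite setUA.
have [lt|ge] := ltnP t (klen k).
  by case/orP: (V t lt) => [-> //|/(coversS (subsetUl _ D)) ->]; rewrite orbT.
have -> : shift i t = shift i' (t - klen k) by rewrite shiftD subnKC.
have tl : t - klen k < word_len ks by lia.
(* A vertex exempt for [c'] can only be the joint, which [E] covers from the left. *)
case/orP: (H _ tl) => [/E /(coversS (subsetUl _ D)) ->|/coversS ->];
  by rewrite ?orbT // setSU.
Qed.

Lemma safe_exposed_dominated i ks m : safe Exposed i ks m -> safe Dominated i ks m.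
Proof.
by case=> D Dm H; exists D => // t /H /= /orP[|->]; rewrite ?inE ?orbT.
Qed.

Lemma safe_dominated_chosen i ks m : safe Dominated i ks m -> safe Chosen i ks m.
Proof.
case=> D Dm H; exists D => // t /H /= /orP[/set1P ->|].
  by rewrite covers_mem ?orbT // !inE eqxx.
by rewrite set0U => /coversS ->; rewrite ?orbT ?subsetUr.
Qed.

Lemma safe_nil c i : safe c i [::] 0.
Proof. by exists set0; rewrite ?cards0. Qed.

(** * Crossing one piece *)

Section Transitions.
Variables (k : kind) (i : 'I_n) (ks : seq kind) (m : nat).
Hypothesis ki : present i k.
Let i' := shift i (klen k).

Lemma chosen_to_dominated : k <> B ->
  safe Dominated i' ks m -> safe Chosen i (k :: ks) m.
Proof.
move=> kB; apply: (safe_step (X := set0)); rewrite ?cards0 ?sub0set //= setU0.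
  move=> v /set1P ->; apply: (covers_near ki (s := 0)); rewrite ?set11 //.
  by case: k kB.
by move=> t tk; rewrite (covers_near ki (s := 0)) ?orbT ?set11 //; case: k kB tk => //= _; lia.
Qed.

(** The end joint is bought. The only vertex it may miss is the start of a [B], which is already
    dominated. *)
Lemma dominated_to_chosen : safe Chosen i' ks m -> safe Dominated i (k :: ks) m.+1.
Proof.
apply: (safe_step (X := [set x i'])); rewrite ?cards1 /= ?set0U ?subxx //.
  by move=> v; rewrite inE.
case=> [|t] tk; first by rewrite set11.
by rewrite (covers_near ki (s := klen k)) ?orbT ?set11 //; case: k tk => //=; lia.
Qed.

Lemma exposed_to_chosen : k <> B ->
  safe Chosen i' ks m -> safe Exposed i (k :: ks) m.+1.
Proof.
move=> kB; apply: (safe_step (X := [set x i'])); rewrite ?cards1 /= ?set0U ?subxx //.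
  by move=> v; rewrite inE.
by move=> t tk; rewrite (covers_near ki (s := klen k)) ?orbT ?set11 //; case: k kB tk => //=; lia.
Qed.

Lemma dominated_to_exposed : k = O ->
  safe Exposed i' ks m -> safe Dominated i (k :: ks) m.
Proof.
move=> kO; apply: (safe_step (X := set0)); rewrite ?cards0 ?sub0set //=.
  by move=> v; rewrite inE.
by rewrite kO => -[|//] _; rewrite set11.
Qed.

(** The start of a [B] dominates all of it but the far end, which is left exposed at no cost. *)
Lemma chosen_to_exposed : k = B ->
  safe Exposed i' ks m -> safe Chosen i (k :: ks) m.
Proof.
move=> kB; apply: (safe_step (X := set0)); rewrite ?cards0 ?sub0set //= setU0.
  by move=> v; rewrite inE.
by move=> t tk; rewrite (covers_near ki (s := 0)) ?orbT ?set11 //; move: tk; rewrite kB /=; lia.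
Qed.

(** The first inner vertex of a [B] is bought: it is adjacent to the three others. *)
Lemma exposed_to_dominated : k = B ->
  safe Dominated i' ks m -> safe Exposed i (k :: ks) m.+1.
Proof.
move=> kB; apply: (safe_step (X := [set x (shift i 1)]));
  rewrite ?cards1 ?sub0set //= set0U.
  by move=> v /set1P ->; rewrite /i'; apply: (covers_near ki (s := 1)); rewrite ?set11 // kB.
by move=> t tk; rewrite (covers_near ki (s := 1)) ?orbT ?set11 //; move: tk; rewrite kB /=; lia.
Qed.

End Transitions.

(* Crossing a piece permutes the three statuses, except that at an A the exposed
   case is handled as if it led to exposed, a weakening of chosen. *)
Lemma three_walkers ks i : laid i ks -> exists mC mD mE,
  [/\ safe Chosen i ks mC, safe Dominated i ks mD, safe Exposed i ks mE &
   mC + mD + mE <= sumn [seq (if k is O then 1 else 2) | k <- ks]].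
Proof.
elim: ks i => [|k ks IH] i; first by exists 0, 0, 0; split=> //; apply: safe_nil.
case=> ki /IH[mC [mD [mE [C D E le]]]]; case: k ki C D E => ki C D E /=.
- exists mD, mC.+1, mE.+1; split; [exact: chosen_to_dominated|exact: dominated_to_chosen| |lia].
  by apply: exposed_to_chosen => //; apply/safe_dominated_chosen/safe_exposed_dominated.
- exists mE, mC.+1, mD.+1; split; [exact: chosen_to_exposed|exact: dominated_to_chosen| |lia].
  exact: exposed_to_dominated.
- exists mD, mE, mC.+1; split; [exact: chosen_to_dominated|exact: dominated_to_exposed| |lia].
  exact: exposed_to_chosen.
Qed.

(* The offsets 0, 1, 2 are potentials of the unordered pairs of statuses; the
   amortized cost of a B is 3/2, that of an A or O is 1. *)
Lemma two_walkers ks i : laid i ks ->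
  let q := sumn [seq (if k is B then 3 else 2) | k <- ks] in
  [/\ exists mC mD, [/\ safe Chosen i ks mC, safe Dominated i ks mD & 2 * (mC + mD) <= q],
      exists mC mE, [/\ safe Chosen i ks mC, safe Exposed i ks mE & 2 * (mC + mE) <= q + 1]
    & exists mD mE, [/\ safe Dominated i ks mD, safe Exposed i ks mE & 2 * (mD + mE) <= q + 2]].
Proof.
elim: ks i => [|k ks IH] i.
  by split; exists 0, 0; split=> //; apply: safe_nil.
case=> ki /IH[[mC [mD [C D le]]] [mC1 [mE1 [C1 E1 le1]]] [mD2 [mE2 [D2 E2 le2]]]] /=.
(* At an [A], a dominated and an exposed walker both become chosen; the exposed one then continues
   with the set for dominated, which also serves chosen. *)
have D' := safe_dominated_chosen D; case: k ki C D D' C1 E1 D2 E2 => ki C D D' C1 E1 D2 E2 /=.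
- split; [exists mD, mC.+1|exists mD, mC.+1|exists mC.+1, mD.+1]; split; try lia;
    by [exact: chosen_to_dominated|exact: dominated_to_chosen|exact: exposed_to_chosen].
- split; [exists mE1, mC1.+1|exists mE2, mD2.+1|exists mC.+1, mD.+1]; split; try lia;
    by [exact: chosen_to_exposed|exact: dominated_to_chosen|exact: exposed_to_dominated].
- split; [exists mD, mC.+1|exists mD, mC.+1|exists mE1, mC1.+1]; split; try lia;
    by [exact: chosen_to_dominated|exact: dominated_to_chosen|exact: exposed_to_chosen|exact: dominated_to_exposed].
Qed.

(** * From partial sets to the domination number *)

Lemma domination_number_le (D : {set T}) :
  (forall v, covers D v) -> domination_number e <= #|D|.
Proof.
move=> H; rewrite /domination_number; case: arg_minnP => [|D0 _]; last apply.
  (* The default [[set: T]] of the arg min is itself dominating. *)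
  by apply/forallP=> v; rewrite inE.
apply/forallP=> v; have /exists_inP[u uD /orP[/eqP <-|uv]] := H v; first by rewrite uD.
by apply/orP; right; apply/exists_inP; exists u.
Qed.

Hypothesis surj_x : forall v, exists i, v = x i.

(** The extra vertex is [x i]: it is the given vertex if chosen and covers the exempt one if
    dominated. As the word has length n, the offsets t < n reach every vertex. *)
Lemma domination_number_safe c i ks m : word_len ks = n -> safe c i ks m ->
  domination_number e <= m.+1.
Proof.
move=> ksn [D Dm H]; apply: (leq_trans (@domination_number_le (x i |: D) _)); last first.
  by rewrite (leq_trans (leq_card_setU _ _)) // cards1 add1n ltnS.
move=> v; have [j ->] := surj_x v; have [t tn ->] := shift_reach i j.
have gi : given c i :|: D \subset x i |: D by rewrite setSU //; case: c {H}; rewrite ?sub0set.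
rewrite -ksn in tn; case/orP: (H t tn) => [|/coversS ->//].
by case: c {H gi} => /=; rewrite !inE // => /eqP ->; apply: covers_mem; rewrite !inE eqxx.
Qed.

End CycleGraph.

(** * Counting pieces and 2-chords *)

Section Decomposition.
Variables (T : finType) (e : rel T) (n : nat) (x : 'I_n -> T).

Lemma laid_pieces (s : seq (piece n)) p :
  all (is_piece e x) (p :: s) ->
  path (fun p q => piece_end p == piece_start q) p s ->
  laid e x p.2 (map fst (p :: s)).
Proof.
elim: s p => [|q s IH] [k i] /=; first by case/andP=> /andP[].
move=> /andP[/andP[ki _] qs] /andP[/eqP E ps]; split=> //.
have <- : q.2 = shift i (klen k) by rewrite -[q.2]E; case: k {ki E}.
exact: IH.
Qed.

Lemma word_lenE (s : seq (piece n)) : word_len (map fst s) = \sum_(p <- s) klen p.1.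
Proof. by rewrite /word_len -map_comp sumnE big_map. Qed.

Lemma kind_counts (ks : seq kind) : exists a b o,
  [/\ word_len ks = 2 * a + 3 * b + o,
      sumn [seq (klen k).-1 | k <- ks] = a + 2 * b,
      sumn [seq (if k is O then 1 else 2) | k <- ks] = 2 * a + 2 * b + o &
      sumn [seq (if k is B then 3 else 2) | k <- ks] = 2 * a + 3 * b + 2 * o].
Proof.
elim: ks => [|k ks [a [b [o [E1 E2 E3 E4]]]]]; first by exists 0, 0, 0.
rewrite /word_len /= -/(word_len ks) E1 E2 E3 E4.
by case: k; [exists a.+1, b, o|exists a, b.+1, o|exists a, b, o.+1]; split=> /=; lia.
Qed.

Hypotheses (sym_e : symmetric e) (hamH : hamilton_cycle e x).

(** The step sets are disjoint, as two pieces share at most one vertex, and they cover all indices,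
    as every cycle edge lies in a piece. *)
Lemma word_len_decomposition s : 4 < n -> is_decomposition e x s ->
  word_len (map fst s) = n.
Proof.
case: hamH => _ /bij_inj inj_x hx n5 [_ _ _ Es disj]; rewrite word_lenE.
apply/eqP; rewrite eqn_leq; apply/andP; split.
  have -> : \sum_(p <- s) klen p.1 = \sum_(p <- s) #|steps p|.
    by apply: eq_bigr => p _; rewrite card_steps //; lia.
  rewrite card_bigcup_seq_disjoint; first by rewrite -[leqRHS]card_ord max_card.
  by apply: sub_pairwise disj => p q; apply: steps_disjoint => //; lia.
have <- : \sum_(p <- s) #|steps p| = \sum_(p <- s) klen p.1.
  by apply: eq_bigr => p _; rewrite card_steps //; lia.
apply: leq_trans (card_bigcup_seq _ _).
rewrite -[leqLHS]card_ord -cardsT; apply/subset_leq_card/subsetP=> i _.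
have : [set x i; x (shift i 1)] \in edges e
  by apply/imset2P; exists (x i) (x (shift i 1)); rewrite ?inE ?hx.
by rewrite -Es; apply: bigcup_seq_sub => p; apply: step_in_piece.
Qed.

Lemma card_two_chords s : 4 < n -> is_decomposition e x s ->
  #|two_chords e x| <= sumn [seq (klen k).-1 | k <- map fst s].
Proof.
case: hamH => _ /bij_inj inj_x hx n5 [_ _ _ Es disj].
rewrite -map_comp sumnE big_map.
apply: (@leq_trans (\sum_(p <- s) #|chords_of x p|)); last first.
  by apply: leq_sum => p _; apply: card_chords_of.
apply: leq_trans (card_bigcup_seq _ _); apply/subset_leq_card/subsetP=> E.
rewrite inE -Es => /andP[EE /existsP[i /eqP Ei]]; move: EE; rewrite Ei.
by apply: bigcup_seq_sub => p; apply: chord_in_piece.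
Qed.

(** One vertex suffices for n = 3 and two opposite ones for n = 4, where 7 * 2 = 2 * 4 + 6 is
    tight. *)
Lemma domination_number_small : n < 5 -> 7 * domination_number e <= 2 * n + 6.
Proof.
case: hamH => n3 [y _ yK] hx n5.
have surj v : exists i, v = x i by exists (y v).
have i : 'I_n by apply: (@Ordinal n 0); lia.
have adj t : e (x (shift i t)) (x (shift i t.+1)) by rewrite -addn1 -shiftD.
have xi : shift i n = i := shift_size i.
suff [D Dn H] : exists2 D : {set T}, 7 * #|D| <= 2 * n + 6 &
    forall t, t < n -> covers e D (x (shift i t)).
  apply: leq_trans Dn; rewrite leq_mul2l; apply: domination_number_le => v.
  by have [j ->] := surj v; have [t tn ->] := shift_reach i j; apply: H.
have [n4|n4] := ltnP n 4.
  have {}n3 : n = 3 by lia.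
  exists [set x i]; first by rewrite cards1; lia.
  rewrite {1}n3 => -[|[|[|//]]] _; apply/exists_inP; exists (x i); rewrite ?set11 ?eqxx //.
    by rewrite (adj 0) orbT.
  by have := adj 2; rewrite -n3 xi sym_e => ->; rewrite orbT.
have {}n4 : n = 4 by lia.
exists [set x i; x (shift i 2)]; first by rewrite cards2; case: eqP; lia.
rewrite {1}n4 => -[|[|[|[|//]]]] _; apply/exists_inP.
- by exists (x i); rewrite ?set21 ?eqxx.
- by exists (x i); rewrite ?set21 ?(adj 0) ?orbT.
- by exists (x (shift i 2)); rewrite ?set22 ?eqxx.
- by exists (x (shift i 2)); rewrite ?set22 ?(adj 2) ?orbT.
Qed.

Lemma domination_number_habo : HABO_graph e x -> n.+1 <= 2 * #|two_chords e x| ->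
  7 * domination_number e <= 2 * n + 6.
Proof.
case=> _ _ [s ds] ch.
have [n5|n5] := ltnP n 5; first exact: domination_number_small.
have wl := word_len_decomposition n5 ds; have tc := card_two_chords n5 ds.
case: hamH => _ [y _ yK] _; case: ds => al srt _ _ _.
have surj v : exists i, v = x i by exists (y v).
case: s => [|p s] in al srt wl tc; first by move: wl; rewrite /word_len /=; lia.
have ld := laid_pieces al srt.
have [mC3 [mD3 [mE3 [C3 D3 E3 le3]]]] := three_walkers sym_e ld.
have [[mC [mD [C D le2]]] _ _] := two_walkers sym_e ld.
have [a [b [o [cl cc c3 c2]]]] := kind_counts (map fst (p :: s)).
have bound c m := @domination_number_safe _ e n x surj c p.2 _ m wl.
have := bound _ _ C3; have := bound _ _ D3; have := bound _ _ E3.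
have := bound _ _ C; have := bound _ _ D.
rewrite c3 in le3; rewrite c2 in le2; rewrite cc in tc; rewrite cl in wl.
(* With g the domination number, the walkers give 3g <= 2a + 2b + o + 3 and 4g <= 2a + 3b + 2o + 4.
   Adding these and using o + 1 <= b, which comes from the 2-chords, yields 7g <= 4a + 6b + 2o + 6 =
   2n + 6. *)
lia.
Qed.

End Decomposition.

(** * Passing to the ceiling *)

Local Open Scope ring_scope.

Theorem theorem3p1 (T : finType) (e : rel T) (n : nat) (x : 'I_n -> T)
    (simpleK : simple_graph e) (cardK : #|T| = n) (hamH : hamilton_cycle e x)
    (HABO : HABO_graph e x)
    (chords : n.+1%:R / 2%:R <= #|two_chords e x|%:R :> rat) :
  (domination_number e)%:Z <= Num.ceil ((2 * n)%:R / 7%:R : rat).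
Proof.
have ch : (n.+1 <= 2 * #|two_chords e x|)%N.
  by move: chords; rewrite ler_pdivrMr // -natrM ler_nat mulnC.
have := domination_number_habo simpleK.1 hamH HABO ch.
(* For a value g + 1 the goal says that g is below the ceiling, i.e. 7g < 2n, which is 7(g + 1) <=
   2n + 6. The value 0 has no such g and only needs a nonnegative ceiling. *)
case: (domination_number e) => [_|g le7].
  by rewrite ceil_ge0 (lt_le_trans _ (divr_ge0 (ler0n _ _) (ler0n _ _))) // ltrN10.
rewrite -addn1 PoszD -ltzD1 ltrD2r ceil_gt_int ltr_pdivlMr // -natrM ltr_nat; lia.
Qed.
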